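(* Let $\lambda$ be a partition with $r$ parts, $\rho=(r-1,\dots,0)$, $\Theta\in\{\Gamma,\Delta\}^r$ and $1\le i\le r-1$ with $\Theta_i\ne\Theta_{i+1}$. For every state $\mathfrak s\in\mathfrak S^\Theta_{\lambda+\rho}$, \[ \mathrm{wt}(t_{r-i}\mathfrak s)(\mathbf z)=\mathrm{wt}(\mathfrak s)(s_i\mathbf z), \] where $s_i\mathbf z$ is $\mathbf z=(z_1,\dots,z_r)$ with $z_i$ and $z_{i+1}$ swapped.
   Context: Palette $\mathcal P=\{c_1<\dots<c_m\}$; fix $\kappa\in\mathcal P^r$ and an integer $N\ge\lambda_1+r$. Fused crystal vertices: left/right and top/bottom edges each carry $\varnothing$ or one colour. Configurations (left, top, right, bottom), parameter $z$, unlisted weight $0$. Gamma: $(\varnothing,\varnothing,\varnothing,\varnothing)\mapsto1$; $(c_a,c_b,c_a,c_b)\mapsto0$ if $a<b$, $z$ if $a\ge b$; $(c_a,c_b,c_b,c_a)\mapsto z$ if $a<b$, $0$ if $a>b$; $(\varnothing,c_a,\varnothing,c_a)\mapsto0$; $(c_a,\varnothing,c_a,\varnothing)\mapsto z$; $(c_a,\varnothing,\varnothing,c_a)\mapsto z$; $(\varnothing,c_a,c_a,\varnothing)\mapsto1$. Delta: $(\varnothing,\varnothing,\varnothing,\varnothing)\mapsto z$; $(c_a,c_b,c_a,c_b)\mapsto1$ if $a\le b$, $0$ if $a>b$; $(c_b,c_b,c_a,c_a)\mapsto0$ if $a<b$, $1$ if $a>b$; $(\varnothing,c_a,\varnothing,c_a)\mapsto0$;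 $(c_a,\varnothing,c_a,\varnothing)\mapsto1$; $(\varnothing,\varnothing,c_a,c_a)\mapsto z$; $(c_a,c_a,\varnothing,\varnothing)\mapsto1$. Lattice: rows $1..r$ top to bottom, columns $0..N-1$ right to left; row $t$ vertices of type $\Theta_t$, parameter $z_t$. $\mathfrak S^\Theta_{\lambda+\rho}$: edge labellings with all vertex weights nonzero, top boundary edge of column $\lambda_t+r-t$ carrying $\kappa_t$, other top edges and all bottom edges empty, and in row $t$: if $\Theta_t=\Gamma$ left boundary empty and right boundary occupied, if $\Theta_t=\Delta$ right empty and left occupied. $\mathrm{wt}(\mathfrak s)(\mathbf z)$: product of vertex weights. Gelfand–Tsetlin patterns: arrays $(a_{i,j})_{0\le i\le j\le r-1}$ of nonnegative integers with $a_{i-1,j-1}\ge a_{i,j}\ge a_{i-1,j}$; $\mathrm{GTP}^{\Theta'}_\nu$ ($\Theta'\in\{\Gamma,\Delta\}^{r-1}$): patterns with top row $\nu$ whose row pair $(j-1,j)$ satisfies $a_{j-1,l-1}>a_{j,l}$ for all $l$ if $\Theta'_j=\Gamma$, and $a_{j,l}>a_{j-1,l}$ for all $l$ if $\Theta'_j=\Delta$. $\iota_\Theta:\mathfrak S^\Theta_{\lambda+\rho}\to\mathrm{GTP}^{(\Theta_1,\dots,\Theta_{r-1})}_{\lambda+\rho}$ sends a state to the pattern whose row $j$ lists in decreasing order the column numbers of occupied vertical edges directly below lattice row $j$ (row $0$: top boundary); it is a bijection. The involution $t_{r-i}$ on patterns changes only row $i$, replacing $a_{i,l}$ by $\min(a_{i-1,l-1},a_{i+1,l})+\max(a_{i-1,l},a_{i+1,l+1})-a_{i,l}$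 (nonexistent entries of row $i+1$ omitted); when $\Theta_i\ne\Theta_{i+1}$ it maps $\mathrm{GTP}^{(\Theta_1,\dots,\Theta_{r-1})}_{\lambda+\rho}$ onto $\mathrm{GTP}^{((s_i\Theta)_1,\dots,(s_i\Theta)_{r-1})}_{\lambda+\rho}$. On states, $t_{r-i}:=\iota_{s_i\Theta}^{-1}\circ t_{r-i}\circ\iota_\Theta:\mathfrak S^\Theta_{\lambda+\rho}\to\mathfrak S^{s_i\Theta}_{\lambda+\rho}$, where $s_i\Theta$ swaps $\Theta_i,\Theta_{i+1}$. *)

(* Defs.v *)
From HB Require Import structures.
From mathcomp Require Import all_boot all_order all_algebra.
From mathcomp Require Import perm zify.

Set Implicit Arguments.
Unset Strict Implicit.
Unset Printing Implicit Defensive.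

Import GRing.Theory.
Local Open Scope nat_scope.

Inductive vtype := Gamma | Delta.

(* The palette c_1 < ... < c_m is 'I_m with its natural order; None is the
   empty edge.  Edges are listed in the order (left, top, right, bottom). *)
Definition vweight (R : nzRingType) (m : nat) (z : R) (T : vtype)
    (l t r b : option 'I_m) : R :=
  match T, l, t, r, b with
  | Gamma, None,   None,   None,   None   => 1%R
  | Gamma, Some x, Some y, Some u, Some v =>
      if (u == x) && (v == y) then (if x < y then 0%R else z)
      else if (u == y) && (v == x) then (if x < y then z else 0%R)
      else 0%R
  | Gamma, None,   Some _, None,   Some _ => 0%R
  | Gamma, Some x, None,   Some u, None   => if x == u then z else 0%R
  | Gamma, Some x, None,   None,   Some v => if x == v then z else 0%R
  | Gamma, None,   Some y, Some u, None   => if y == u then 1%R else 0%R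
  | Delta, None,   None,   None,   None   => z
  | Delta, Some x, Some y, Some u, Some v =>
      if (u == x) && (v == y) then (if x <= y then 1%R else 0%R)
      else if (y == x) && (v == u) then (if u < x then 0%R else 1%R)
      else 0%R
  | Delta, None,   Some _, None,   Some _ => 0%R
  | Delta, Some x, None,   Some u, None   => if x == u then 1%R else 0%R
  | Delta, None,   None,   Some u, Some v => if u == v then z else 0%R
  | Delta, Some x, Some y, None,   None   => if x == y then 1%R else 0%R
  | _, _, _, _, _ => 0%R
  end.

(* Weights are compared with 0 as polynomials in an indeterminate, so that
   being a state does not depend on the values given to the parameters. *)
Definition admissible (m : nat) (T : vtype) (l t r b : option 'I_m) : bool :=
  (vweight ('X : {poly int})%R T l t r b != 0)%R.

(* Rows are numbered from the top and columns from the right, starting at 0.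
   In the first component, edge (k, c) is the right edge of the vertex in row k
   and column c and edge (k, c + 1) its left edge; in the second, (k, c) is its
   top edge and (k + 1, c) its bottom edge. *)
Definition labelling (m r N : nat) : finType :=
  ({ffun 'I_r * 'I_N.+1 -> option 'I_m} *
   {ffun 'I_r.+1 * 'I_N -> option 'I_m})%type.

Section Edges.
Context (m r N : nat).
Implicit Types (x : labelling m r N) (k : 'I_r) (c : 'I_N).

Definition left_edge x k c := x.1 (k, lift ord0 c).
Definition right_edge x k c := x.1 (k, widen_ord (leqnSn N) c).
Definition top_edge x k c := x.2 (widen_ord (leqnSn r) k, c).
Definition bottom_edge x k c := x.2 (lift ord0 k, c).
End Edges.

Definition lambda_rho (r : nat) (lam : r.-tuple nat) : r.-tuple nat :=
  [tuple tnth lam t + (r.-1 - t) | t < r].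

Definition is_state (m r N : nat) (kappa : 'I_r -> 'I_m) (lam : r.-tuple nat)
    (Theta : 'I_r -> vtype) (x : labelling m r N) : bool :=
  [&& [forall k, forall c, admissible (Theta k) (left_edge x k c)
         (top_edge x k c) (right_edge x k c) (bottom_edge x k c)],
      [forall t, forall c : 'I_N, (val c == tnth (lambda_rho lam) t) ==>
         (x.2 (ord0, c) == Some (kappa t))],
      [forall c : 'I_N, (val c \notin lambda_rho lam) ==>
         (x.2 (ord0, c) == None)],
      [forall c : 'I_N, x.2 (ord_max, c) == None] &
      [forall k, match Theta k with
        | Gamma => (x.1 (k, ord_max) == None) && (x.1 (k, ord0) != None)
        | Delta => (x.1 (k, ord0) == None) && (x.1 (k, ord_max) != None)
        end]].

Definition state (m r N : nat) (kappa : 'I_r -> 'I_m) (lam : r.-tuple nat)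
    (Theta : 'I_r -> vtype) : finType :=
  {x : labelling m r N | is_state kappa lam Theta x}.

Definition wt (R : comNzRingType) (m r N : nat) (kappa : 'I_r -> 'I_m)
    (lam : r.-tuple nat) (Theta : 'I_r -> vtype)
    (s : state N kappa lam Theta) (z : 'I_r -> R) : R :=
  (\prod_(k < r) \prod_(c < N) vweight (z k) (Theta k)
     (left_edge (val s) k c) (top_edge (val s) k c)
     (right_edge (val s) k c) (bottom_edge (val s) k c))%R.

(* Row i of a triangular array is the list of a_{i,i}, ..., a_{i,r-1}. *)
Definition rows (r : nat) := r.-tuple (seq nat).

Definition entry (r : nat) (a : rows r) (i j : nat) : nat :=
  nth 0 (nth [::] a i) (j - i).

(* Thetap k concerns the pair of rows (k, k + 1). *)
Definition is_GTP (r : nat) (Thetap : 'I_r.-1 -> vtype) (nu : r.-tuple nat)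
    (a : rows r) : bool :=
  [&& [forall i : 'I_r, size (tnth a i) == r - i],
      nth [::] a 0 == nu,
      [forall i : 'I_r, forall j : 'I_r, (0 < i <= j) ==>
         (entry a i.-1 j <= entry a i j <= entry a i.-1 j.-1)] &
      [forall k : 'I_r.-1, forall l : 'I_r, (k < l) ==>
         match Thetap k with
         | Gamma => entry a k l.-1 > entry a k.+1 l
         | Delta => entry a k.+1 l > entry a k l
         end]].

Definition GTP (r : nat) (Thetap : 'I_r.-1 -> vtype) (nu : r.-tuple nat) :=
  {a : rows r | is_GTP Thetap nu a}.

Definition trunc (T : Type) (r : nat) (f : 'I_r -> T) : 'I_r.-1 -> T :=
  fun k => f (widen_ord (leq_pred r) k).

(* For 0 < i < r the pair (before i, i) of ordinals is the pair of positions
   (i, i + 1) in the numbering from 1, and swap_at i is s_i. *)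
Definition before (r : nat) (i : 'I_r) : 'I_r :=
  Ordinal (leq_ltn_trans (leq_pred i) (ltn_ord i)).

Definition swap_at (T : Type) (r : nat) (i : 'I_r) (f : 'I_r -> T) : 'I_r -> T :=
  fun k => f (tperm (before i) i k).

(* Entry (i, l) of the image of a under the involution t_{r-i}.  Row i + 1 has
   no entries (i + 1, i) and (i + 1, r).  On patterns the subtraction is
   exact. *)
Definition flip_entry (r : nat) (a : rows r) (i l : nat) : nat :=
  (if l == i then entry a i.-1 l.-1
   else minn (entry a i.-1 l.-1) (entry a i.+1 l))
  + (if l == r.-1 then entry a i.-1 l
     else maxn (entry a i.-1 l) (entry a i.+1 l.+1))
  - entry a i l.

Definition flip (r : nat) (i : 'I_r) (a : rows r) : rows r :=
  [tuple if k == i then [seq flip_entry a i l | l <- iota i (r - i)]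
         else tnth a k | k < r].

(* Columns of the occupied vertical edges at level k, in decreasing order;
   level 0 is the top boundary and level k + 1 lies just below row k. *)
Definition occupied (m r N : nat) (x : labelling m r N) (k : 'I_r.+1) :
    seq nat :=
  rev [seq val c | c <- enum 'I_N & x.2 (k, c) != None].

Definition iota_rows (m r N : nat) (x : labelling m r N) : rows r :=
  [tuple occupied x (widen_ord (leqnSn r) k) | k < r].

Section DecreasingLists.
Implicit Types L A B : seq nat.

Let cnt L c := count (leq c) L.

Lemma cnt_eq0 L c : (forall y, y \in L -> y < c) -> cnt L c = 0.
Proof.
move=> h; apply/eqP; rewrite -leqn0 leqNgt -has_count; apply/negP.
by case/hasP=> y /h /=; lia.
Qed.

Lemma cnt_nth L k c : sorted gtn L -> k < size L ->
  (c <= nth 0 L k) = (k < cnt L c).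
Proof.
have gt_trans : transitive gtn by move=> y x z /= h1 h2; exact: ltn_trans h2 h1.
elim: L k => //= x L IH [|k] sL /=.
  move=> _; rewrite /cnt /=; case: (leqP c x) => //= lt_xc.
  have /allP hL : all (gtn x) L by exact: order_path_min sL.
  have := @cnt_eq0 L c; rewrite /cnt => -> // y /hL /=; lia.
move=> ltk; rewrite IH ?(path_sorted sL) // /cnt /=.
case: (leqP c x) => //= lt_xc; rewrite add0n.
have /allP hL : all (gtn x) L by exact: order_path_min sL.
by have := @cnt_eq0 L c; rewrite /cnt => -> // y /hL /=; lia.
Qed.

Lemma cntS L c : sorted gtn L -> cnt L c = cnt L c.+1 + (c \in L).
Proof.
move=> sL; have uL : uniq L.
  apply: sorted_uniq sL; last by move=> ?; rewrite /= ltnn.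
  by move=> y x z /= h1 h2; exact: ltn_trans h2 h1.
rewrite -count_uniq_mem // /cnt -count_predUI.
rewrite -[LHS]addn0; congr (_ + _).
  by apply: eq_count => y /=; lia.
by symmetry; rewrite (@eq_count _ _ pred0) ?count_pred0 // => y /=; lia.
Qed.

Lemma cnt0 L : cnt L 0 = size L.
Proof. by rewrite /cnt (@eq_count _ _ predT) ?count_predT. Qed.

Lemma cnt_size L c : cnt L c <= size L.
Proof. exact: count_size. Qed.

Lemma nth_cntS L c : sorted gtn L -> c \in L -> nth 0 L (cnt L c.+1) = c.
Proof.
move=> sL cL; have E := cntS c sL; rewrite cL /= in E.
have lt : cnt L c.+1 < size L by have := cnt_size L c; lia.
have := cnt_nth c sL lt; have := cnt_nth c.+1 sL lt; lia.
Qed.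

Lemma interlace_of_cnt A B : sorted gtn A -> sorted gtn B ->
  (forall c, cnt B c <= cnt A c <= (cnt B c).+1) -> size A = (size B).+1 ->
  forall k, k < size B -> nth 0 A k.+1 <= nth 0 B k <= nth 0 A k.
Proof.
move=> sA sB h sz k ltk; apply/andP; split.
  rewrite cnt_nth //; have := h (nth 0 A k.+1).
  by have := cnt_nth (nth 0 A k.+1) sA (_ : k.+1 < size A); rewrite leqnn; lia.
rewrite cnt_nth //; last by lia.
by have := h (nth 0 B k); have := cnt_nth (nth 0 B k) sB ltk; rewrite leqnn; lia.
Qed.

Lemma cnt_of_interlace A B : sorted gtn A -> sorted gtn B ->
  size A = (size B).+1 ->
  (forall k, k < size B -> nth 0 A k.+1 <= nth 0 B k <= nth 0 A k) ->
  forall c, cnt B c <= cnt A c <= (cnt B c).+1.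
Proof.
move=> sA sB sz h c; apply/andP; split.
  case E: (cnt B c) => [|k] //.
  have ltk : k < size B by have := cnt_size B c; lia.
  have hB := cnt_nth c sB ltk; have hA := cnt_nth c sA (_ : k < size A).
  by have := h k ltk; lia.
case E: (cnt A c) => [|[|k]] //.
have ltk : k.+1 < size A by have := cnt_size A c; lia.
have hA := cnt_nth c sA ltk; have hB := cnt_nth c sB (_ : k < size B).
by have := h k; lia.
Qed.

Lemma dec_list_eq A B : sorted gtn A -> sorted gtn B -> A =i B -> A = B.
Proof.
apply: irr_sorted_eq; last by move=> ?; rewrite /= ltnn.
by move=> y x z /= h1 h2; exact: ltn_trans h2 h1.
Qed.

Lemma dec_nth A : (forall k, k.+1 < size A -> nth 0 A k.+1 < nth 0 A k) ->
  sorted gtn A.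
Proof. by move=> h; apply/(sortedP 0) => i /h. Qed.

End DecreasingLists.

Section LocalRule.
Context (m : nat).
Implicit Types (T : vtype) (l t r b x : option 'I_m).

(* Paths enter a vertex from the top and, horizontally, from the left (Gamma)
   or from the right (Delta).  Their colours and the occupancy of the bottom
   edge determine the two outgoing edges (horizontal, bottom). *)
Definition step T x t (b : bool) : option 'I_m * option 'I_m :=
  match x, t with
  | Some p, Some q =>
      match T with
      | Gamma => if p < q then (Some q, Some p) else (Some p, Some q)
      | Delta => if p <= q then (Some p, Some q) else (Some q, Some p)
      end
  | None, None => (None, None)
  | Some p, None | None, Some p => if b then (None, Some p) else (Some p, None)
  end.

Definition hin T l r := if T is Gamma then l else r.
Definition hout T l r := if T is Gamma then r else l.

Lemma admissibleE T l t r b : admissible T l t r b =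
  ((hout T l r, b) == step T (hin T l r) t b) &&
  ~~ [&& ~~ hin T l r, isSome t & isSome b].
Proof.
have nX : (('X : {poly int}) != 0)%R by rewrite polyX_eq0.
have n1 : ((1 : {poly int}) != 0)%R by rewrite oner_eq0.
have E := eqxx (0%R : {poly int}).
have S1 (p q : 'I_m) : (Some p == Some q) = (p == q :> nat) by [].
have S2 (p q : 'I_m) : (p == q) = (p == q :> nat) by [].
case: T; case: l => [p|]; case: t => [q|]; case: r => [u|]; case: b => [v|];
  rewrite /admissible /vweight /hin /hout /step /= ?nX ?n1 ?E ?andbT ?andbF //=;
  rewrite ?S2; repeat case: ifP => //=; 
  rewrite ?nX ?n1 ?E ?xpair_eqE ?S1 ?andbT ?andbF //=; lia.
Qed.

Lemma step_occ T x t (b o : bool) : isSome x + isSome t = o + b ->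
  isSome (step T x t b).1 = o /\ isSome (step T x t b).2 = b.
Proof.
by case: T x t b o => [] [p|] [q|] [] [] //= _; case: ifP.
Qed.

Lemma admissible_occ T l t r b : admissible T l t r b ->
  [/\ isSome (hin T l r) + isSome t = isSome (hout T l r) + isSome b,
      (hout T l r, b) = step T (hin T l r) t b &
      ~~ [&& ~~ hin T l r, isSome t & isSome b]].
Proof.
rewrite admissibleE => /andP[/eqP E ->]; split=> //.
move: (hin T l r) (hout T l r) E => x o.
by case: T x t o b => [] [p|] [q|] [u|] [v|] //=; case: ifP.
Qed.

End LocalRule.


Definition rowpair (T : vtype) (A B : seq nat) : Prop :=
  size A = (size B).+1 /\ forall k, k < size B ->
    nth 0 A k.+1 <= nth 0 B k <= nth 0 A k /\
    (match T with
     | Gamma => nth 0 B k < nth 0 A k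
     | Delta => nth 0 A k.+1 < nth 0 B k
     end : bool).

Lemma rowpair_sorted T A B : rowpair T A B -> sorted gtn B.
Proof.
case=> sz h; apply: dec_nth => k ltk.
have [h1 h2] := h k (ltnW ltk); have [h3 h4] := h k.+1 ltk.
by case: T h2 h4 h => h2 h4 _; lia.
Qed.

Lemma GTPP (r : nat) (Theta : 'I_r -> vtype) (nu : r.-tuple nat) (a : rows r) :
  is_GTP (trunc Theta) nu a <-> nth [::] a 0 = nu /\
    forall k : 'I_r, rowpair (Theta k) (nth [::] a k) (nth [::] a k.+1).
Proof.
split.
  case/and4P=> /forallP sz /eqP -> /forallP il /forallP st; split=> // k.
  have szE n : size (nth [::] a n) = r - n.
    have [ltn|len] := ltnP n r; last by rewrite nth_default ?size_tuple //=; lia.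
    by have /eqP := sz (Ordinal ltn); rewrite (tnth_nth [::]).
  split; first by rewrite !szE; have := ltn_ord k; lia.
  move=> q; rewrite szE => ltq.
  have ltl : q + k.+1 < r by lia.
  have ltk1 : k.+1 < r by lia.
  have ltk2 : k < r.-1 by lia.
  have /forallP/(_ (Ordinal ltl))/implyP /= := il (Ordinal ltk1).
  have /forallP/(_ (Ordinal ltl))/implyP /= := st (Ordinal ltk2).
  rewrite /trunc (_ : widen_ord _ _ = k); last exact: val_inj.
  rewrite /entry (_ : q + k.+1 - k.+1 = q); last lia.
  rewrite (_ : q + k.+1 - k = q.+1); last lia.
  rewrite (_ : (q + k.+1).-1 - k = q); last lia.
  have ltk : k < q + k.+1 by lia.
  by move=> h1 h2; split; [exact: h2 ltk | exact: (h1 ltk)].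
case=> E0 h.
have szE n : n <= r -> size (nth [::] a n) = r - n.
  elim: n => [|n IH] len; first by rewrite E0 size_tuple subn0.
  by have [sz _] := h (Ordinal len); move: sz; rewrite /= IH //; lia.
apply/and4P; split.
- by apply/forallP=> i; rewrite (tnth_nth [::]) szE // ltnW.
- exact/eqP.
- apply/forallP=> i; apply/forallP=> j; apply/implyP=> hij.
  have hi1 : i.-1 < r by have := ltn_ord i; lia.
  have [_] := h (Ordinal hi1); rewrite /= (_ : i.-1.+1 = i); last lia.
  move=> /(_ (j - i)); rewrite szE; last by apply: ltnW.
  case; first by have := ltn_ord j; lia.
  move=> + _; rewrite /entry.
  rewrite (_ : (j - i).+1 = j - i.-1); last lia.
  by rewrite (_ : j.-1 - i.-1 = j - i) //; lia.
apply/forallP=> k; apply/forallP=> l; apply/implyP=> hkl.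
have hk : k < r by have := ltn_ord k; lia.
have [_ /(_ (l - k.+1))] := h (widen_ord (leq_pred r) k).
rewrite /= szE; last by have := ltn_ord k; lia.
case; first by have := ltn_ord l; lia.
move=> _; rewrite /entry /trunc.
rewrite (_ : (l - k.+1).+1 = l - k); last lia.
by rewrite (_ : l.-1 - k = l - k.+1) //; lia.
Qed.

Lemma flip_row_nth (r : nat) (i : 'I_r) (a : rows r) q : q < r - i ->
  nth 0 (nth [::] (flip i a) i) q = flip_entry a i (q + i).
Proof.
move=> ltq; rewrite -(tnth_nth [::] (flip i a) i) tnth_mktuple eqxx.
by rewrite (nth_map 0) ?size_iota // nth_iota // addnC.
Qed.

Lemma flip_row_size (r : nat) (i : 'I_r) (a : rows r) :
  size (nth [::] (flip i a) i) = r - i.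
Proof.
by rewrite -(tnth_nth [::] (flip i a) i) tnth_mktuple eqxx size_map size_iota.
Qed.

Lemma flip_row_other (r : nat) (i : 'I_r) (a : rows r) (k : nat) : k != i ->
  nth [::] (flip i a) k = nth [::] a k.
Proof.
move=> neq; have [ltk|lek] := ltnP k r; last first.
  by rewrite !nth_default // size_tuple.
rewrite -(tnth_nth [::] _ (Ordinal ltk)) tnth_mktuple ifN //.
by rewrite (tnth_nth [::]).
Qed.

Lemma flip_bounds (P Q S : nat -> nat) (T T' : vtype) (n : nat) :
  T <> T' ->
  (forall q, q <= n -> P q.+1 <= Q q <= P q /\
     (match T with Gamma => Q q < P q | Delta => P q.+1 < Q q end : bool)) ->
  (forall q, q < n -> Q q.+1 <= S q <= Q q /\
     (match T' with Gamma => S q < Q q | Delta => Q q.+1 < S q end : bool)) ->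
  let mn q := if q == 0 then P q else minn (P q) (S q.-1) in
  let mx q := if q == n then P q.+1 else maxn (P q.+1) (S q) in
  forall q, q <= n -> let Q' := mn q + mx q - Q q in
    mx q <= Q' <= mn q /\
    (match T' with Gamma => Q' < mn q | Delta => mx q < Q' end : bool).
Proof.
move=> hT hP hS mn mx q leq_qn Q'.
have [hmn smn] : Q q <= mn q /\ (T = Gamma -> T' = Delta -> Q q < mn q).
  have [h1 h2] := hP q leq_qn; rewrite /mn.
  case: q leq_qn @Q' h1 h2 => [|q] leq_qn _ h1 h2 /=.
    by split=> [|ET _]; [lia | rewrite ET in h2].
  have [h3 h4] := hS q leq_qn.
  by split=> [|ET ET']; [lia | rewrite ET in h2; rewrite ET' in h4; lia].
have [hmx smx] : mx q <= Q q /\ (T = Delta -> T' = Gamma -> mx q < Q q).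
  have [h1 h2] := hP q leq_qn; rewrite /mx.
  have [E|nE] := eqVneq q n.
    by split=> [|ET _]; [lia | rewrite ET in h2].
  have ltqn : q < n by lia.
  have [h3 h4] := hS q ltqn.
  by split=> [|ET ET']; [lia | rewrite ET in h2; rewrite ET' in h4; lia].
rewrite /Q'; split; first by lia.
move: hT smn smx; clear hP hS; case: T; case: T' => //= _ smn smx.
  by have := smn erefl erefl; lia.
by have := smx erefl erefl; lia.
Qed.

Lemma flip_GTP (r : nat) (Theta : 'I_r -> vtype) (nu : r.-tuple nat)
    (i : 'I_r) (a : rows r) : 0 < i -> Theta (before i) <> Theta i ->
  is_GTP (trunc Theta) nu a -> is_GTP (trunc (swap_at i Theta)) nu (flip i a).
Proof.
move=> hi hT /GTPP[E0 h]; apply/GTPP; split.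
  by rewrite flip_row_other //; lia.
have szE n : n <= r -> size (nth [::] a n) = r - n.
  elim: n => [|n IH] len; first by rewrite E0 size_tuple subn0.
  by have [sz _] := h (Ordinal len); move: sz; rewrite /= IH //; lia.
have [_ hP] := h (before i); have [_ hQ] := h i.
have lir := ltn_ord i.
rewrite /= (_ : i.-1.+1 = i) in hP; last lia.
have szi : size (nth [::] a i) = r - i by rewrite szE // ltnW.
have szi1 : size (nth [::] a i.+1) = r - i.+1 by rewrite szE.
have szp : size (nth [::] a i.-1) = (r - i).+1 by rewrite szE; lia.
have hP' q : q <= r.-1 - i -> q < size (nth [::] a i) by rewrite szi; lia.
have hQ' q : q < r.-1 - i -> q < size (nth [::] a i.+1) by rewrite szi1; lia.
have hb := flip_bounds hT (fun q H => hP q (hP' q H)) (fun q H => hQ q (hQ' q H)).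
have Q'E q : q < r - i -> nth 0 (nth [::] (flip i a) i) q =
    (if q == 0 then nth 0 (nth [::] a i.-1) q
     else minn (nth 0 (nth [::] a i.-1) q) (nth 0 (nth [::] a i.+1) q.-1))
  + (if q == r.-1 - i then nth 0 (nth [::] a i.-1) q.+1
     else maxn (nth 0 (nth [::] a i.-1) q.+1) (nth 0 (nth [::] a i.+1) q))
  - nth 0 (nth [::] a i) q.
  move=> ltq; rewrite flip_row_nth // /flip_entry /entry.
  rewrite (_ : (q + i == i) = (q == 0)); last lia.
  rewrite (_ : (q + i == r.-1) = (q == r.-1 - i)); last lia.
  rewrite (_ : (q + i).-1 - i.-1 = q); last lia.
  rewrite (_ : q + i - i.-1 = q.+1); last lia.
  rewrite (_ : q + i - i.+1 = q.-1); last lia.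
  rewrite (_ : (q + i).+1 - i.+1 = q); last lia.
  by rewrite addnK.
have swB : swap_at i Theta (before i) = Theta i by rewrite /swap_at tpermL.
have swI : swap_at i Theta i = Theta (before i) by rewrite /swap_at tpermR.
move=> k.
have [->|nk] := eqVneq k i; [|have [->|nk'] := eqVneq k (before i)].
- rewrite swI (flip_row_other a (_ : i.+1 != i)); last lia.
  split; first by rewrite flip_row_size szi1; lia.
  move=> q; rewrite szi1 => ltq.
  have [] := hb q (_ : _); first lia.
  have [] := hb q.+1 (_ : _); first lia.
  rewrite -!Q'E; [|lia..].
  rewrite (_ : (q == r.-1 - i) = false); last lia.
  move: (nth 0 (nth [::] (flip i a) i)) (nth 0 (nth [::] a i.-1)) => f P.
  move: (nth 0 (nth [::] a i.+1)) => S /=.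
  move: hT; case: (Theta (before i)); case: (Theta i) => //= _; clear;
    by case: (q == 0); case: ifP => _; lia.
- rewrite swB /= (_ : i.-1.+1 = i); last lia.
  rewrite (flip_row_other a (_ : i.-1 != i)); last lia.
  split; first by rewrite flip_row_size szp.
  move=> q; rewrite flip_row_size => ltq.
  have [] := hb q (_ : _); first lia.
  rewrite -!Q'E //.
  move: (nth 0 (nth [::] (flip i a) i)) (nth 0 (nth [::] a i.-1)) => f P.
  move: (nth 0 (nth [::] a i)) (nth 0 (nth [::] a i.+1)) => Q S; clear.
  by case: (Theta i); case: ifP => _; case: ifP => _; lia.
have kE : swap_at i Theta k = Theta k.
  by rewrite /swap_at tpermD // eq_sym.
rewrite kE flip_row_other // flip_row_other //.
by apply: contra nk' => /eqP E; apply/eqP/val_inj; rewrite /= -E.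
Qed.

Section Occupied.
Context (m r N : nat).
Implicit Types (x : labelling m r N).

Lemma occupied_sorted x k : sorted gtn (occupied x k).
Proof.
rewrite /occupied rev_sorted.
rewrite (_ : sorted _ _ = sorted ltn [seq val c | c <- enum 'I_N & x.2 (k, c) != None]) //.
rewrite sorted_map.
apply: sorted_filter; first by move=> b a c /=; exact: ltn_trans.
have : sorted ltn (map val (enum 'I_N)) by rewrite val_enum_ord iota_ltn_sorted.
by rewrite sorted_map.
Qed.

Lemma mem_occupied x k (c : 'I_N) : (val c \in occupied x k) = isSome (x.2 (k, c)).
Proof.
rewrite /occupied mem_rev (mem_map val_inj) mem_filter mem_enum andbT.
by case: (x.2 _).
Qed.

Lemma occupied_lt x k c : c \in occupied x k -> c < N.
Proof. by rewrite /occupied mem_rev => /mapP[d _ ->]; exact: ltn_ord. Qed.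

Lemma nth_iota_rows x (k : 'I_r) :
  nth [::] (iota_rows x) k = occupied x (widen_ord (leqnSn r) k).
Proof. by rewrite -(tnth_nth [::] (iota_rows x) k) tnth_mktuple. Qed.

Lemma nth_iota_rowsS x (k : 'I_r) : occupied x ord_max = [::] ->
  nth [::] (iota_rows x) k.+1 = occupied x (lift ord0 k).
Proof.
move=> h; have [ltk|lek] := ltnP k.+1 r.
  rewrite -[k.+1]/(val (Ordinal ltk)) nth_iota_rows; congr occupied.
  exact: val_inj.
rewrite nth_default ?size_tuple // -h; congr occupied.
by apply: val_inj; rewrite /= /bump /=; have := ltn_ord k; lia.
Qed.

End Occupied.

Lemma lambda_rho_sorted (r : nat) (lam : r.-tuple nat) :
  sorted geq lam -> sorted gtn (lambda_rho lam).
Proof.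
move=> hl; apply/(sortedP 0) => t; rewrite size_tuple => ltt.
have ltt' : t < r by exact: ltnW.
rewrite -(tnth_nth 0 _ (Ordinal ltt)) -(tnth_nth 0 _ (Ordinal ltt')).
rewrite !tnth_mktuple /= !(tnth_nth 0) /=.
have /(sortedP 0) /(_ t) := hl; rewrite size_tuple => /(_ ltt) /=; lia.
Qed.

Lemma lambda_rho_lt (r N : nat) (lam : r.-tuple nat) c :
  sorted geq lam -> head 0 lam + r <= N -> c \in lambda_rho lam -> c < N.
Proof.
move=> hl hN /tnthP[t ->]; rewrite tnth_mktuple (tnth_nth 0).
have geq_trans : transitive geq by move=> y x z /= h1 h2; exact: leq_trans h2 h1.
have : nth 0 lam t <= nth 0 lam 0.
  apply: (sorted_leq_nth geq_trans (fun y => leqnn y) 0 hl 0 t);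
    by rewrite ?inE ?size_tuple //; have := ltn_ord t; lia.
by rewrite nth0; have := ltn_ord t; lia.
Qed.

Section StateToPattern.
Context (m r N : nat) (kappa : 'I_r -> 'I_m) (lam : r.-tuple nat).
Context (Theta : 'I_r -> vtype).
Context (hlam : sorted geq lam).
Context (hN : head 0 lam + r <= N).

Lemma occupied_top (x : labelling m r N) : is_state kappa lam Theta x ->
  occupied x ord0 = lambda_rho lam.
Proof.
case/and5P=> _ /forallP h1 /forallP h2 _ _.
apply: dec_list_eq; first exact: occupied_sorted.
  exact: lambda_rho_sorted.
move=> c; have [ltc|lec] := ltnP c N; last first.
  by apply/idP/idP => [/occupied_lt|/(lambda_rho_lt hlam hN)]; lia.
rewrite -[c]/(val (Ordinal ltc)) mem_occupied.
apply/idP/idP => [|/tnthP[t Et]].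
  apply: contraLR => hc; have /implyP/(_ hc)/eqP -> // := h2 (Ordinal ltc).
have /forallP/(_ (Ordinal ltc))/implyP := h1 t.
by rewrite -Et eqxx => /(_ isT)/eqP ->.
Qed.

Lemma occupied_bottom (x : labelling m r N) : is_state kappa lam Theta x ->
  occupied x ord_max = [::].
Proof.
case/and5P=> _ _ _ /forallP h _; rewrite /occupied.
by rewrite (@eq_filter _ _ pred0) ?filter_pred0 // => c; rewrite (eqP (h c)).
Qed.

(* Number of paths crossing a row between its two vertical edge lists. *)
Definition flow (T : vtype) (o : bool) := if T is Gamma then o else ~~ o.

Lemma state_count (x : labelling m r N) (k : 'I_r) (c : nat) :
  is_state kappa lam Theta x -> forall hc : c < N.+1,
  count (leq c) (occupied x (widen_ord (leqnSn r) k)) =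
  count (leq c) (occupied x (lift ord0 k)) +
    flow (Theta k) (isSome (x.1 (k, Ordinal hc))).
Proof.
case/and5P=> /forallP/(_ k)/forallP hv _ _ _ /forallP/(_ k) hs.
have [n le_n] : exists n, n = N - c by exists (N - c).
elim: n c le_n => [|n IH] c En hc.
  have Ec : c = N by lia.
  rewrite !cnt_eq0; [|by move=> y /occupied_lt; lia..].
  rewrite (_ : Ordinal hc = ord_max); last exact: val_inj.
  by case: (Theta k) hs => /= /andP[]; case: (x.1 (k, ord_max)).
have ltc : c < N by lia.
have hc1 : c.+1 < N.+1 by [].
rewrite !(cntS c (occupied_sorted _ _)) (IH c.+1 _ hc1); last lia.
rewrite -[X in X \in _]/(val (Ordinal ltc)) -[X in _ + (X \in _) + _]/(val (Ordinal ltc)).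
rewrite !mem_occupied.
have [+ _ _] := admissible_occ (hv (Ordinal ltc)).
rewrite /left_edge /right_edge /top_edge /bottom_edge.
rewrite (_ : lift ord0 (Ordinal ltc) = Ordinal hc1); last exact: val_inj.
rewrite (_ : widen_ord _ (Ordinal ltc) = Ordinal hc); last exact: val_inj.
by case: (Theta k) => /=; case: (x.1 _); case: (x.1 _) => *; lia.
Qed.

Lemma state_rowpair (x : labelling m r N) (k : 'I_r) :
  is_state kappa lam Theta x ->
  rowpair (Theta k) (occupied x (widen_ord (leqnSn r) k))
    (occupied x (lift ord0 k)).
Proof.
move=> hx; have hc := state_count k hx.
set A := occupied x (widen_ord (leqnSn r) k) in hc *.
set B := occupied x (lift ord0 k) in hc *.
have sA : sorted gtn A by exact: occupied_sorted.
have sB : sorted gtn B by exact: occupied_sorted.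
have szAB : size A = (size B).+1.
  have := hc 0 isT; rewrite -!cnt0 => ->.
  case/and5P: hx => _ _ _ _ /forallP/(_ k).
  rewrite (_ : Ordinal _ = ord0); last exact: val_inj.
  by rewrite -/B; case: (Theta k) => /= /andP[]; case: (x.1 (k, ord0)) => //= *; rewrite addn1.
have hcnt c : count (leq c) B <= count (leq c) A <= (count (leq c) B).+1.
  have [ltc|lec] := ltnP c N.+1; first by rewrite (hc c ltc); case: flow => /=; lia.
  by rewrite !cnt_eq0 // => y /occupied_lt; lia.
split=> // q ltq; have il := interlace_of_cnt sA sB hcnt szAB ltq.
split=> //.
have /and5P[/forallP/(_ k)/forallP hv _ _ _ _] := hx.
set b := nth 0 B q in il *.
have bB : b \in B by exact: mem_nth.
have ltb : b < N by exact: occupied_lt bB.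
have ltb0 : b < N.+1 by lia.
have ltb1 : b.+1 < N.+1 by lia.
have Eb := cnt_nth b sB ltq; rewrite -/b leqnn in Eb.
have Eb1 := cnt_nth b.+1 sB ltq; rewrite -/b ltnn in Eb1.
have EB := cntS b sB; rewrite bB in EB.
have EA := cntS b sA.
have [_ _] := admissible_occ (hv (Ordinal ltb)).
rewrite /left_edge /right_edge /top_edge /bottom_edge -!mem_occupied /= -/A -/B bB andbT.
rewrite (_ : lift ord0 (Ordinal ltb) = Ordinal ltb1); last exact: val_inj.
rewrite (_ : widen_ord _ (Ordinal ltb) = Ordinal ltb0); last exact: val_inj.
have := hc b ltb0; have := hc b.+1 ltb1; rewrite -/A -/B.
case: (Theta k) => /= h1 h2 h3.
- rewrite ltn_neqAle; case/andP: il => _ ->; rewrite andbT; apply/eqP=> Eab.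
  have ltqA : q < size A by lia.
  have bA : b \in A by rewrite Eab mem_nth.
  rewrite bA andbT /= negbK in h3; rewrite h3 /= in h1.
  have := cnt_nth b.+1 sA ltqA; rewrite -Eab ltnn; lia.
- rewrite ltn_neqAle; case/andP: il => -> _; rewrite andbT; apply/eqP=> Eab.
  have ltqA : q.+1 < size A by lia.
  have bA : b \in A by rewrite -Eab mem_nth.
  rewrite bA andbT /= negbK in h3; rewrite h3 /= in h2.
  have := cnt_nth b sA ltqA; rewrite Eab leqnn; lia.
Qed.

Lemma iota_GTP (x : labelling m r N) : is_state kappa lam Theta x ->
  is_GTP (trunc Theta) (lambda_rho lam) (iota_rows x).
Proof.
move=> hx; apply/GTPP; split.
  have [r0|r_gt0] := posnP r.
    rewrite nth_default ?size_tuple; last by rewrite r0.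
    by symmetry; apply: size0nil; rewrite size_tuple.
  rewrite -[0]/(val (Ordinal r_gt0)) nth_iota_rows -(occupied_top hx).
  by congr occupied; exact: val_inj.
move=> k; rewrite nth_iota_rows nth_iota_rowsS ?(occupied_bottom hx) //.
exact: state_rowpair.
Qed.

Lemma iota_inj (x y : labelling m r N) : is_state kappa lam Theta x ->
  is_state kappa lam Theta y -> iota_rows x = iota_rows y -> x = y.
Proof.
move=> hx hy E.
have occE (k : 'I_r.+1) c : isSome (x.2 (k, c)) = isSome (y.2 (k, c)).
  rewrite -!mem_occupied; congr (_ \in _).
  have [ltk|lek] := ltnP k r.
    rewrite (_ : k = widen_ord (leqnSn r) (Ordinal ltk)); last exact: val_inj.
    by rewrite -!nth_iota_rows E.
  rewrite (_ : k = ord_max); last by apply: val_inj => /=; have := ltn_ord k; lia.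
  by rewrite (occupied_bottom hx) (occupied_bottom hy).
have /and5P[/forallP hvx /forallP t1x /forallP t2x _ /forallP hsx] := hx.
have /and5P[/forallP hvy /forallP t1y /forallP t2y _ /forallP hsy] := hy.
have vert k c : hin (Theta k) (left_edge x k c) (right_edge x k c) =
      hin (Theta k) (left_edge y k c) (right_edge y k c) ->
    top_edge x k c = top_edge y k c ->
    hout (Theta k) (left_edge x k c) (right_edge x k c) =
      hout (Theta k) (left_edge y k c) (right_edge y k c) /\
    bottom_edge x k c = bottom_edge y k c.
  move=> Eh Et.
  have [_ Ex _] := admissible_occ (forallP (hvx k) c).
  have [_ Ey _] := admissible_occ (forallP (hvy k) c).
  have Eb : isSome (bottom_edge x k c) = isSome (bottom_edge y k c) by exact: occE.
  by move: Ex; rewrite Eh Et Eb -Ey => -[-> ->].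
have row k : (forall c, top_edge x k c = top_edge y k c) ->
    (forall n (hn : n < N.+1), x.1 (k, Ordinal hn) = y.1 (k, Ordinal hn)) /\
    (forall c, bottom_edge x k c = bottom_edge y k c).
  move=> Et.
  have hor : forall n (hn : n < N.+1), x.1 (k, Ordinal hn) = y.1 (k, Ordinal hn).
    have hv' c := vert k c ^~ (Et c).
    have := hsx k; have := hsy k; case ET: (Theta k) hv' => hv' /andP[/eqP ey _] /andP[/eqP ex _].
    - move=> n; have [d Ed] : exists d, d = N - n by exists (N - n).
      elim: d n Ed => [|d IH] n Ed hn.
        rewrite (_ : Ordinal hn = ord_max) ?ex ?ey //.
        by apply: val_inj => /=; lia.
      have hn1 : n.+1 < N.+1 by lia.
      have ltn : n < N by lia.
      have [] := hv' (Ordinal ltn); rewrite /= /left_edge /right_edge.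
        rewrite (_ : lift ord0 _ = Ordinal hn1); last exact: val_inj.
        by apply: IH; lia.
      by rewrite (_ : widen_ord _ _ = Ordinal hn) //; exact: val_inj.
    - elim=> [|n IH] hn.
        by rewrite (_ : Ordinal hn = ord0) ?ex ?ey //; exact: val_inj.
      have hn1 : n < N.+1 by lia.
      have [] := hv' (Ordinal (hn : n < N)); rewrite /= /left_edge /right_edge.
        rewrite (_ : widen_ord _ _ = Ordinal hn1); last exact: val_inj.
        exact: IH.
      by rewrite (_ : lift ord0 _ = Ordinal hn) //; exact: val_inj.
  split=> // c; have [] // := vert k c _ (Et c).
  have hor' (d : 'I_N.+1) : x.1 (k, d) = y.1 (k, d).
    by case: d => d hd; exact: hor.
  by rewrite /left_edge /right_edge !hor'.
have lev n : forall hn : n < r.+1, forall c,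
    x.2 (Ordinal hn, c) = y.2 (Ordinal hn, c).
  elim: n => [|n IH] hn c.
    rewrite (_ : Ordinal hn = ord0); last exact: val_inj.
    have [/tnthP[t Ec]|nc] := boolP (val c \in lambda_rho lam).
      have /forallP/(_ c)/implyP := t1x t; have /forallP/(_ c)/implyP := t1y t.
      by rewrite Ec eqxx => /(_ isT)/eqP -> /(_ isT)/eqP ->.
    have /implyP/(_ nc)/eqP -> := t2x c.
    by have /implyP/(_ nc)/eqP -> := t2y c.
  have hn' : n < r.+1 by lia.
  have [|_ /(_ c)] := row (Ordinal (hn : n < r)).
    move=> d; rewrite /top_edge (_ : widen_ord _ _ = Ordinal hn') ?IH //.
    exact: val_inj.
  rewrite /bottom_edge (_ : lift ord0 _ = Ordinal hn) //; exact: val_inj.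
case: x y {E hx hy hvx hvy t1x t1y t2x t2y hsx hsy occE vert} row lev
  => [xh xv] [yh yv] /= row lev.
congr pair; apply/ffunP=> [[k c]]; last by case: k => k hk; exact: lev.
have [|+ _] := row k; last by case: c => c hc; exact.
by move=> d; rewrite /top_edge /=; case: (widen_ord _ _) => n hn; exact: lev.
Qed.

End StateToPattern.

Section RowFill.
Context (m N : nat) (T : vtype) (A B : seq nat) (u : nat -> option 'I_m).

Fixpoint fill_left (d : nat) : option 'I_m :=
  if d is d'.+1 then
    (step Gamma (fill_left d') (u (N - d)) (N - d \in B)).1
  else None.

Fixpoint fill_right (c : nat) : option 'I_m :=
  if c is c'.+1 then (step Delta (fill_right c') (u c') (c' \in B)).1
  else None.

Definition fill_h (c : nat) :=
  if T is Gamma then fill_left (N - c) else fill_right c.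

Definition fill_b (c : nat) :=
  (step T (hin T (fill_h c.+1) (fill_h c)) (u c) (c \in B)).2.

Lemma fill_step c : c < N -> (hout T (fill_h c.+1) (fill_h c), fill_b c) =
  step T (hin T (fill_h c.+1) (fill_h c)) (u c) (c \in B).
Proof.
move=> ltc; rewrite [RHS]surjective_pairing; congr pair.
rewrite /fill_h; case: T => //=.
rewrite (_ : N - c = (N - c.+1).+1); last lia.
by rewrite [LHS]/= (_ : N - (N - c.+1).+1 = c) //; lia.
Qed.

Context (hAB : rowpair T A B).
Context (sA : sorted gtn A).
Context (ltA : forall c : nat, c \in A -> c < N).
Context (uA : forall c, c < N -> isSome (u c) = (c \in A)).

Let sB : sorted gtn B := rowpair_sorted hAB.

Lemma rowpair_lt (c : nat) : c \in B -> c < N.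
Proof.
case: hAB => sz h /(nthP 0)[k ltk <-]; have [] := h k ltk.
case/andP=> _ hk _; apply: leq_ltn_trans hk _; apply: ltA.
by rewrite mem_nth // sz; exact: ltnW ltk.
Qed.

Let g c := count (leq c) A != count (leq c) B.

Let gE c : count (leq c) A = count (leq c) B + g c.
Proof.
have [sz h] := hAB.
have := cnt_of_interlace sA sB sz (fun k hk => (h k hk).1) c.
by rewrite /g; case: eqVneq => /=; lia.
Qed.

Let gS (c : nat) : (c \in A) + g c.+1 = (c \in B) + g c.
Proof.
have := gE c; rewrite (cntS c sA) (cntS c sB) (gE c.+1) -!addnA.
by move/addnI; rewrite [LHS]addnC. Qed.

Let gN : g N = false.
Proof. by rewrite /g !cnt_eq0 // => y /rowpair_lt. Qed.

Let g0 : g 0 = true.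
Proof. by have := gE 0; rewrite !cnt0; have [-> _] := hAB; case: (g 0); lia. Qed.

Lemma fill_h_occ c : c <= N -> isSome (fill_h c) = flow T (g c).
Proof.
rewrite /fill_h; case: T.
  move=> lec; have [d Ed] : exists d, d = N - c by exists (N - c).
  rewrite -Ed; elim: d c Ed lec => [|d IH] c Ed lec.
    by rewrite /= (_ : c = N) ?gN //; lia.
  rewrite [fill_left _]/= (_ : N - d.+1 = c); last lia.
  apply: (step_occ Gamma (b := c \in B) _).1.
  have ltc : c < N by lia.
  by rewrite (IH c.+1) /=; [rewrite uA // addnC gS addnC|lia..].
elim: c => [|c IH] lec; first by rewrite /= g0.
apply: (step_occ Delta (b := c \in B) _).1.
rewrite IH; last by lia.
rewrite uA //; move: (gS c); rewrite /=.
by case: (g c); case: (g c.+1); case: (c \in A); case: (c \in B).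
Qed.

Lemma fill_occ c : c < N ->
  isSome (hin T (fill_h c.+1) (fill_h c)) + isSome (u c) =
  isSome (hout T (fill_h c.+1) (fill_h c)) + (c \in B).
Proof.
move=> ltc; have h0 := fill_h_occ (ltnW ltc); have h1 := fill_h_occ ltc.
have := gS c; rewrite uA //; move: h0 h1.
by case: T => /= -> ->; case: (g c); case: (g c.+1);
  case: (c \in A); case: (c \in B).
Qed.

Lemma fill_b_occ c : c < N -> isSome (fill_b c) = (c \in B).
Proof. by move=> ltc; exact: (step_occ T (fill_occ ltc)).2. Qed.

Lemma fill_admissible c : c < N ->
  admissible T (fill_h c.+1) (u c) (fill_h c) (fill_b c).
Proof.
move=> ltc; rewrite admissibleE fill_b_occ // fill_step // eqxx /=.
apply/negP=> /and3P[hn]; rewrite uA // => cA cB.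
have h0 := fill_h_occ (ltnW ltc); have h1 := fill_h_occ ltc.
have EA := cntS c sA; have EB := cntS c sB; rewrite cA cB in EA EB.
have nA := nth_cntS sA cA; have nB := nth_cntS sB cB.
have ltB : count (leq c.+1) B < size B by have := cnt_size B c; rewrite EB; lia.
have [_ /(_ _ ltB)] := hAB; rewrite nB => -[_].
have := gE c.+1; have := gE c; have := gS c.
move: hn h0 h1 nA; rewrite cA cB.
case: T => /= hn h0 h1 nA Ec E0 E1.
- have g1 : g c.+1 = false by rewrite -h1; apply/negbTE.
  by rewrite g1 addn0 in E1; rewrite -E1 nA; lia.
- have g1 : g c.+1 = true by case: (g c) (g c.+1) h0 hn Ec => [] [] //= ->.
  by rewrite g1 addn1 in E1; rewrite -E1 nA; lia.
Qed.

Lemma fill_boundary :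
  match T with
  | Gamma => (fill_h N == None) && (fill_h 0 != None)
  | Delta => (fill_h 0 == None) && (fill_h N != None)
  end.
Proof.
have := fill_h_occ (leqnn N); have := fill_h_occ (leq0n N); rewrite gN g0.
by case: T => /=; case: (fill_h 0) => [?|]; case: (fill_h N) => [?|].
Qed.

End RowFill.

Section PatternToState.
Context (m r N : nat) (kappa : 'I_r -> 'I_m) (lam : r.-tuple nat).
Context (Theta : 'I_r -> vtype).
Context (hlam : sorted geq lam).
Context (hN : head 0 lam + r <= N).

Lemma iota_onto (a : rows r) : is_GTP (trunc Theta) (lambda_rho lam) a ->
  exists2 x : labelling m r N, is_state kappa lam Theta x & iota_rows x = a.
Proof.
move=> /GTPP[E0 h].
pose R n := nth [::] a n.
have srt n : n <= r -> sorted gtn (R n).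
  case: n => [|n] len; first by rewrite /R E0 lambda_rho_sorted.
  exact: rowpair_sorted (h (Ordinal len)).
have ltR n : n <= r -> forall c : nat, c \in R n -> c < N.
  elim: n => [|n IH] len.
    by rewrite /R E0 => c; exact: lambda_rho_lt.
  by apply: rowpair_lt (h (Ordinal len)) _; apply: IH; exact: ltnW.
pose top (c : nat) := omap kappa [pick t | tnth (lambda_rho lam) t == c].
pose Th n := if insub n is Some k then Theta k else Gamma.
pose vc := fix vc n := if n is n'.+1
  then fill_b N (Th n') (R n'.+1) (vc n') else top.
have ThE (k : 'I_r) : Th k = Theta k by rewrite /Th valK.
have topE c : isSome (top c) = (c \in R 0).
  rewrite /R E0 /top; case: pickP => [t /eqP <-|nt]; first by rewrite mem_tnth.
  by apply/esym/negP => /tnthP[t Et]; have := nt t; rewrite -Et eqxx.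
have vcE n : n <= r -> forall c, c < N -> isSome (vc n c) = (c \in R n).
  elim: n => [|n IH] len c ltc; first exact: topE.
  have lenr := ltnW len.
  have rp := h (Ordinal len); rewrite -ThE in rp.
  exact: fill_b_occ rp (srt n lenr) (ltR n lenr) (IH lenr) _ ltc.
pose x : labelling m r N :=
  ([ffun kc => fill_h N (Th (val kc.1)) (R (val kc.1).+1) (vc (val kc.1)) (val kc.2)],
   [ffun kc => vc (val kc.1) (val kc.2)]).
have occE (k : 'I_r.+1) : occupied x k = R k.
  have lek : k <= r by rewrite -ltnS.
  apply: dec_list_eq; [exact: occupied_sorted | exact: srt |] => c.
  have [ltc|lec] := ltnP c N; last first.
    by apply/idP/idP => [/occupied_lt|/(ltR k lek)]; lia.
  by rewrite -[c]/(val (Ordinal ltc)) mem_occupied ffunE vcE.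
exists x; last first.
  apply: eq_from_tnth => k.
  by rewrite (tnth_nth [::]) nth_iota_rows occE [RHS](tnth_nth [::]).
have rowP (k : 'I_r) := h k.
have bnd (k : 'I_r) := fill_boundary (h k) (srt k (ltnW (ltn_ord k)))
  (ltR k (ltnW (ltn_ord k))) (vcE k (ltnW (ltn_ord k))).
have adm (k : 'I_r) := fill_admissible (h k) (srt k (ltnW (ltn_ord k)))
  (ltR k (ltnW (ltn_ord k))) (vcE k (ltnW (ltn_ord k))).
apply/and5P; split.
- apply/forallP=> k; apply/forallP=> c.
  rewrite /left_edge /right_edge /top_edge /bottom_edge /x !ffunE /= /bump /=.
  by rewrite !add1n /= ThE; exact: adm.
- apply/forallP=> t; apply/forallP=> c; apply/implyP=> /eqP Ec.
  rewrite /x ffunE /= /top; case: pickP => [t' /eqP Et'|/(_ t)]; last first.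
    by rewrite Ec eqxx.
  rewrite /= (_ : t' = t) //; apply/val_inj.
  have u : uniq (lambda_rho lam).
    apply: sorted_uniq (lambda_rho_sorted hlam).
      by move=> y z w /= h1 h2; exact: ltn_trans h2 h1.
    by move=> y; rewrite /= ltnn.
  apply/eqP; rewrite -(nth_uniq 0 _ _ u) ?size_tuple ?ltn_ord //.
  by rewrite -!tnth_nth Et' Ec.
- apply/forallP=> c; apply/implyP=> nc; rewrite /x ffunE /=.
  by have := topE c; rewrite /R E0 (negbTE nc); case: (top c).
- apply/forallP=> c; rewrite /x ffunE.
  have := vcE r (leqnn r) c (ltn_ord c).
  by rewrite /R nth_default ?size_tuple // /=; case: (vc r c).
apply/forallP=> k; have := bnd k; rewrite /x !ffunE /= ThE.
by case: (Theta k).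
Qed.

End PatternToState.

Definition iota_map (m r N : nat) (kappa : 'I_r -> 'I_m) (lam : r.-tuple nat)
    (hlam : sorted geq lam) (hN : head 0 lam + r <= N) (Theta : 'I_r -> vtype)
    (s : state N kappa lam Theta) : GTP (trunc Theta) (lambda_rho lam) :=
  exist _ (iota_rows (val s)) (iota_GTP hlam hN (valP s)).

Arguments iota_map {m r N kappa lam} hlam hN {Theta} s.

Lemma iota_map_inj m r N kappa lam hlam hN Theta :
  injective (@iota_map m r N kappa lam hlam hN Theta).
Proof.
move=> s s' /(congr1 val) /= E; apply: val_inj.
exact: iota_inj (valP s) (valP s') E.
Qed.

Lemma iota_map_surj m r N kappa lam hlam hN Theta p :
  exists s, @iota_map m r N kappa lam hlam hN Theta s == p.
Proof.
have [x hx Ex] := iota_onto kappa hlam hN (valP p).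
by exists (exist _ x hx); apply/eqP/val_inj.
Qed.

Definition iota_inv (m r N : nat) (kappa : 'I_r -> 'I_m) (lam : r.-tuple nat)
    (hlam : sorted geq lam) (hN : head 0 lam + r <= N) (Theta : 'I_r -> vtype)
    (p : GTP (trunc Theta) (lambda_rho lam)) : state N kappa lam Theta :=
  xchoose (iota_map_surj kappa hlam hN p).

Arguments iota_inv {m r N} kappa {lam} hlam hN {Theta} p.

Lemma iota_invK m r N kappa lam hlam hN Theta :
  cancel (@iota_inv m r N kappa lam hlam hN Theta) (iota_map hlam hN).
Proof. by move=> p; exact/eqP/(xchooseP (iota_map_surj kappa hlam hN p)). Qed.

Lemma iota_mapK m r N kappa lam hlam hN Theta :
  cancel (@iota_map m r N kappa lam hlam hN Theta) (iota_inv kappa hlam hN).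
Proof. by move=> s; apply: (@iota_map_inj _ _ _ _ _ hlam hN); rewrite iota_invK. Qed.

Definition flip_pattern (r : nat) (Theta : 'I_r -> vtype) (nu : r.-tuple nat)
    (i : 'I_r) (hi : 0 < i) (hTheta : Theta (before i) <> Theta i)
    (p : GTP (trunc Theta) nu) : GTP (trunc (swap_at i Theta)) nu :=
  exist _ (flip i (val p)) (flip_GTP hi hTheta (valP p)).

Definition flip_state (m r N : nat) (kappa : 'I_r -> 'I_m) (lam : r.-tuple nat)
    (hlam : sorted geq lam) (hN : head 0 lam + r <= N) (Theta : 'I_r -> vtype)
    (i : 'I_r) (hi : 0 < i) (hTheta : Theta (before i) <> Theta i)
    (s : state N kappa lam Theta) : state N kappa lam (swap_at i Theta) :=
  iota_inv kappa hlam hN (flip_pattern hi hTheta (iota_map hlam hN s)).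

(* Main.v *)
Require Import Defs.
From HB Require Import structures.
From mathcomp Require Import all_boot all_order all_algebra.
From mathcomp Require Import perm zify.

Set Implicit Arguments.
Unset Strict Implicit.
Unset Printing Implicit Defensive.

Import GRing.Theory.
Local Open Scope nat_scope.

(** The weight of a state does not see the colours: a vertex of a state weighs
    z or 1, and it weighs z exactly when a path crosses its left edge (Gamma) or
    when its left edge is free (Delta).  By particle conservation the number of
    such vertices in a row is, for either type, the difference of the sums of
    the column numbers occupied above and below the row.  Hence the weight is
    the monomial of the row sum differences of the pattern, and the involution
    exchanges the two exponents because a row i and its image add up to the sum
    of the rows i - 1 and i + 1. *)

(** Admissibility is tested at the indeterminate, so this covers values of [z] that vanish in
    [R]. *)
Lemma vweight_admissible (R : comNzRingType) (m : nat) (z : R) (T : vtype)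
    (l t r b : option 'I_m) :
  admissible T l t r b -> vweight z T l t r b = (z ^+ flow T l)%R.
Proof.
rewrite /admissible.
by case: T l t r b => [] [p|] [q|] [u|] [v|] /=;
  rewrite ?eqxx ?expr0 ?expr1 //; repeat case: ifP => //=; rewrite eqxx.
Qed.

(** Double counting: an entry x < N is counted once for each c < x. *)
Lemma sum_count_geq (L : seq nat) N : (forall c, c \in L -> c < N) ->
  \sum_(c < N) count (leq c.+1) L = sumn L.
Proof.
elim: L => [|x L IH] h /=; first by rewrite big1.
rewrite big_split /= IH; last by move=> c cL; rewrite h // inE cL orbT.
congr (_ + _).
(* The minimum makes the induction on [N] work, since x < N would not survive it. *)
have -> : \sum_(c < N) (c < x) = minn x N.
  by elim: N {h IH} => [|N IH]; rewrite ?big_ord0 ?big_ord_recr /= ?IH; lia.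
by apply/minn_idPl/ltnW/h/mem_head.
Qed.

(** For k + 1 = r the second row is the default [[::]], matching the empty bottom boundary. *)
Definition row_drop (r : nat) (a : rows r) (k : nat) :=
  sumn (nth [::] a k) - sumn (nth [::] a k.+1).

Section Weight.
Context (m r N : nat) (kappa : 'I_r -> 'I_m) (lam : r.-tuple nat).
Context (hlam : sorted geq lam) (hN : head 0 lam + r <= N).

Lemma sum_flow (Theta : 'I_r -> vtype) (x : labelling m r N) (k : 'I_r) :
  is_state kappa lam Theta x ->
  \sum_(c < N) flow (Theta k) (left_edge x k c) = row_drop (iota_rows x) k.
Proof.
move=> hx; rewrite /row_drop nth_iota_rows nth_iota_rowsS ?(occupied_bottom hx) //.
rewrite -!(@sum_count_geq _ N); [|by move=> c /occupied_lt..].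
apply/esym/eqP; rewrite -(eqn_add2l (\sum_(c < N) count (leq c.+1) (occupied x (lift ord0 k)))).
(* Conservation summed over the columns; the left edge of column c is edge c + 1. *)
have E : \sum_(c < N) count (leq c.+1) (occupied x (widen_ord (leqnSn r) k)) =
    \sum_(c < N) count (leq c.+1) (occupied x (lift ord0 k)) +
    \sum_(c < N) flow (Theta k) (left_edge x k c).
  rewrite -big_split; apply: eq_bigr => c _ /=.
  rewrite (state_count hlam hN k hx (ltn_ord c : c.+1 < N.+1)).
  by congr (_ + flow _ (isSome (x.1 (k, _)))); exact: val_inj.
by rewrite E addKn.
Qed.

Lemma wtE (R : comNzRingType) (Theta : 'I_r -> vtype)
    (s : state N kappa lam Theta) (z : 'I_r -> R) :
  wt s z = (\prod_(k < r) z k ^+ row_drop (iota_rows (val s)) k)%R.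
Proof.
apply: eq_bigr => k _; rewrite -(sum_flow k (valP s)) expr_sum.
apply: eq_bigr => c _; apply: vweight_admissible.
by have /and5P[/forallP/(_ k)/forallP/(_ c)] := valP s.
Qed.

End Weight.

Lemma sumn_nth (L : seq nat) : sumn L = \sum_(q < size L) nth 0 L q.
Proof. by rewrite sumnE (big_nth 0) big_mkord. Qed.

(** The maximum at q and the minimum at q + 1 involve the same two entries, so together they give
    their sum. *)
Lemma sumn_flip (r : nat) (Theta : 'I_r -> vtype) (nu : r.-tuple nat)
    (i : 'I_r) (a : rows r) : 0 < i -> is_GTP (trunc Theta) nu a ->
  sumn (nth [::] (flip i a) i) + sumn (nth [::] a i) =
  sumn (nth [::] a i.-1) + sumn (nth [::] a i.+1).
Proof.
move=> hi /GTPP[_ h]; have lir := ltn_ord i.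
have [szP hP] := h (before i); have [szQ hQ] := h i.
rewrite /= (_ : i.-1.+1 = i) in szP hP; last lia.
have [n En] : exists n, r - i = n.+1 by exists (r - i).-1; lia.
have szi : size (nth [::] a i) = n.+1.
  (* Induction upwards from the empty default row r. *)
  have szE k : k <= r -> size (nth [::] a (r - k)) = k.
    elim: k => [|k IH] lek; first by rewrite nth_default // size_tuple subn0.
    have ltk : r - k.+1 < r by lia.
    have [-> _] := h (Ordinal ltk).
    by rewrite /= (_ : (r - k.+1).+1 = r - k) ?IH //; lia.
  by rewrite -En -(szE (r - i)) ?subKn ?leq_subr // ltnW.
have szi1 : size (nth [::] a i.+1) = n by lia.
rewrite szi in szP hP; rewrite szi1 in hQ.
rewrite !sumn_nth flip_row_size En szP szi szi1 -big_split /=.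
set P := nth 0 (nth [::] a i.-1) in hP *.
set Q := nth 0 (nth [::] a i) in hP hQ *.
set S := nth 0 (nth [::] a i.+1) in hQ *.
pose mn q := if q == 0 then P q else minn (P q) (S q.-1).
pose mx q := if q == n then P q.+1 else maxn (P q.+1) (S q).
rewrite (eq_bigr (fun q : 'I_n.+1 => mn q + mx q)); last first.
  move=> q _; have ltq := ltn_ord q.
  rewrite flip_row_nth ?En // /flip_entry /entry.
  rewrite (_ : (q + i == i) = (q == 0 :> nat)); last lia.
  rewrite (_ : (q + i == r.-1) = (q == n :> nat)); last lia.
  rewrite (_ : (q + i).-1 - i.-1 = q); last lia.
  rewrite (_ : q + i - i.-1 = q.+1); last lia.
  rewrite (_ : q + i - i.+1 = q.-1); last lia.
  rewrite (_ : (q + i).+1 - i.+1 = q); last lia.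
  (* The subtraction is exact because [Q q] is already at most [mn q]. *)
  rewrite addnK -/P -/Q -/S subnK //.
  apply: leq_trans (leq_addr _ _).
  have [/andP[_ leQP] _] := hP q ltq.
  case: eqP => // /eqP nq; rewrite leq_min leQP /=.
  have ltq1 : q.-1 < n by lia.
  by have [/andP[+ _] _] := hQ _ ltq1; rewrite prednK ?lt0n.
(* The first minimum and the last maximum have no partner; they are [P 0] and [P n.+1]. *)
rewrite big_split big_ord_recl [X in _ + X = _]big_ord_recr /=.
rewrite [X in _ = X + _]big_ord_recl [X in _ = (_ + X) + _]big_ord_recr /=.
rewrite {2}/mx eqxx (_ : bump 0 n = n.+1) //.
rewrite -!addnA; congr (_ + _); rewrite addnA [RHS]addnCA addnC; congr (_ + _).
rewrite -!big_split; apply: eq_bigr => q _ /=.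
rewrite /mn /mx /bump /= (ltn_eqF (ltn_ord q)).
by rewrite add1n addn_min_max.
Qed.

(** From Q' + Q = P + S follow P - Q' = Q - S and Q' - S = P - Q, also for truncated subtraction. *)
Lemma row_drop_flip (r : nat) (Theta : 'I_r -> vtype) (nu : r.-tuple nat)
    (i : 'I_r) (a : rows r) (k : 'I_r) : 0 < i -> is_GTP (trunc Theta) nu a ->
  row_drop (flip i a) k = row_drop a (tperm (before i) i k).
Proof.
move=> hi ha; have E := sumn_flip hi ha.
rewrite /row_drop; case: tpermP => [->|->|nb ni].
- rewrite -[nat_of_ord (before i)]/(i.-1) (_ : i.-1.+1 = i); last lia.
  by rewrite (flip_row_other a (_ : i.-1 != i)); lia.
- rewrite -[nat_of_ord (before i)]/(i.-1) (_ : i.-1.+1 = i); last lia.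
  by rewrite (flip_row_other a (_ : i.+1 != i)); lia.
rewrite !flip_row_other //; last by apply/eqP=> /val_inj.
by apply/eqP=> Ek; case: nb; apply: val_inj; rewrite /= -Ek.
Qed.

Theorem theorem4p7 (R : comNzRingType) (m r N : nat) (kappa : 'I_r -> 'I_m)
    (lam : r.-tuple nat) (hlam : sorted geq lam) (hN : head 0 lam + r <= N)
    (Theta : 'I_r -> vtype) (i : 'I_r) (hi : 0 < i)
    (hTheta : Theta (before i) <> Theta i)
    (s : state N kappa lam Theta) (z : 'I_r -> R) :
  wt (flip_state hlam hN hi hTheta s) z = wt s (swap_at i z).
Proof.
have E : iota_rows (val (flip_state hlam hN hi hTheta s)) =
    flip i (iota_rows (val s)).
  by have /(congr1 val) := iota_invK kappa hlam hN
    (flip_pattern hi hTheta (iota_map hlam hN s)).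
(* Reindexing by the transposition moves the swap from the parameters to the exponents. *)
rewrite !(wtE hlam hN) E [RHS](reindex_inj (@perm_inj _ (tperm (before i) i))).
apply: eq_bigr => k _; rewrite /swap_at tpermK.
by rewrite (row_drop_flip k hi (iota_GTP hlam hN (valP s))).
Qed.
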